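(* Let $k\ge 12$ be an even integer and let $p\in W_k^+$. Define coefficients $b_{r,s}\in\mathbb{Q}$ (for integers $r,s\ge 1$ with $r+s=k+1$) by $$p(X+Y,Y)=\sum_{r+s=k+1}\binom{k-1}{r-1}\,b_{r,s}\,X^{r-1}Y^{s-2}.$$ (Since $p(X+Y,Y)$ is a polynomial, $b_{k,1}=0$.) Then in the formal double zeta space $\mathcal{D}_{k+1}$ one has $$\sum_{\substack{r+s=k+1\\ 4\le r\le k-2,\ r\text{ even}}}(b_{r,s}-b_{s,r})\,Z_{r,s}\equiv 0 \pmod{Z_{k+1}},$$ i.e. the left-hand side is a rational multiple of $Z_{k+1}$ in $\mathcal{D}_{k+1}$.
   Context: Formal double zeta space. For an integer $w>2$, $\mathcal{D}_w$ is the $\mathbb{Q}$-vector space generated by formal symbols $Z_{r,s}$, $P_{r,s}$ (for integers $r,s\ge 1$ with $r+s=w$) and $Z_w$, modulo the relations $$Z_{r,s}+Z_{s,r}=P_{r,s}-Z_w\quad (r+s=w,\ r,s\ge1),$$ $$\sum_{\substack{r+s=w\\ r,s\ge 1}}\left[\binom{r-1}{i-1}+\binom{r-1}{j-1}\right]Z_{r,s}=P_{i,j}\quad (i+j=w,\ i,j\ge1).$$ Period polynomials. For even $k$, $V_k$ is the $\mathbb{Q}$-vector space of homogeneous polynomials of degree $k-2$ in $X,Y$ with rational coefficients, and $W_k\subset V_k$ is the subspace of polynomials $P$ satisfying $P(X,Y)+P(-Y,X)=0$ and $P(X,Y)+P(X-Y,X)+P(Y,Y-X)=0$. Then $W_k=W_k^+\oplus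 W_k^-$, where $W_k^+$ (resp. $W_k^-$) is the subspace of polynomials that are symmetric, $P(X,Y)=P(Y,X)$ (resp. antisymmetric, $P(X,Y)=-P(Y,X)$). *)

(* Defs.v *)
From HB Require Import structures.
From mathcomp Require Import all_boot all_order all_algebra.
From mathcomp Require Import ring_quotient.
From mathcomp.multinomials Require Import mpoly.

Set Implicit Arguments.
Unset Strict Implicit.
Unset Printing Implicit Defensive.

Import GRing.Theory.
Local Open Scope ring_scope.
Local Open Scope quotient_scope.

(* The quotient of a vector space by a subspace: [Quotient.quot] only provides
   the additive structure, to which the scaling is added here. *)
Section VspaceQuotient.
Variables (K : fieldType) (V : vectType K) (U : {vspace V}).

Definition vs_quot : Type := Quotient.quot U.

HB.instance Definition _ := GRing.Zmodule.on vs_quot.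

(* Locked, so that unification does not try to compute representatives. *)
Fact vs_pi_key : unit. Proof. exact: tt. Qed.
Definition vs_pi : V -> vs_quot :=
  locked_with vs_pi_key (fun v => \pi_(Quotient.quot U) v).
Canonical vs_pi_unlockable := [unlockable fun vs_pi].

Definition vs_quot_scale (a : K) (x : vs_quot) : vs_quot :=
  vs_pi (a *: repr (x : Quotient.quot U)).

Lemma vs_piP (u v : V) : reflect (vs_pi u = vs_pi v) (u - v \in U).
Proof. by rewrite unlock Quotient.idealrBE; apply: eqP. Qed.

Lemma vs_pi_surj (x : vs_quot) : exists v, x = vs_pi v.
Proof. by exists (repr (x : Quotient.quot U)); rewrite unlock reprK. Qed.

Lemma vs_quot_scale_pi a v : vs_quot_scale a (vs_pi v) = vs_pi (a *: v).
Proof.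
apply/vs_piP; rewrite -scalerBr rpredZ //.
by apply/vs_piP; rewrite unlock reprK.
Qed.

Lemma vs_piD u v : vs_pi (u + v) = vs_pi u + vs_pi v.
Proof. by rewrite unlock; exact: (raddfD \pi_(Quotient.quot U)). Qed.

Lemma vs_quot_scaleA a b x :
  vs_quot_scale a (vs_quot_scale b x) = vs_quot_scale (a * b) x.
Proof. by have [v ->] := vs_pi_surj x; rewrite !vs_quot_scale_pi scalerA. Qed.

Lemma vs_quot_scale1 : left_id 1 vs_quot_scale.
Proof. by move=> x; have [v ->] := vs_pi_surj x; rewrite vs_quot_scale_pi scale1r. Qed.

Lemma vs_quot_scaleDr : right_distributive vs_quot_scale +%R.
Proof.
move=> a x y; have [u ->] := vs_pi_surj x; have [v ->] := vs_pi_surj y.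
by rewrite -vs_piD !vs_quot_scale_pi scalerDr vs_piD.
Qed.

Lemma vs_quot_scaleDl x : {morph vs_quot_scale^~ x : a b / a + b}.
Proof.
move=> a b; have [v ->] := vs_pi_surj x.
by rewrite !vs_quot_scale_pi scalerDl vs_piD.
Qed.

HB.instance Definition _ := GRing.Zmodule_isLmodule.Build K vs_quot
  vs_quot_scaleA vs_quot_scale1 vs_quot_scaleDr vs_quot_scaleDl.

Lemma vs_pi_is_linear : linear vs_pi.
Proof. by move=> a u v; rewrite vs_piD -vs_quot_scale_pi. Qed.

HB.instance Definition _ := GRing.isLinear.Build K V vs_quot *:%R vs_pi
  vs_pi_is_linear.

Lemma vs_piB u v : vs_pi (u - v) = vs_pi u - vs_pi v.
Proof. exact: linearB. Qed.

Lemma vs_piZ a v : vs_pi (a *: v) = a *: vs_pi v.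
Proof. exact: linearZ. Qed.

Lemma vs_pi_sum (I : Type) (r : seq I) (P : pred I) (F : I -> V) :
  vs_pi (\sum_(i <- r | P i) F i) = \sum_(i <- r | P i) vs_pi (F i).
Proof. exact: linear_sum. Qed.

End VspaceQuotient.

(* The pairs of integers r, s >= 1 with r + s = w: under that equation,
   r < w and s < w amount to s >= 1 and r >= 1. *)
Definition compos2 (w : nat) : Type :=
  {rs : 'I_w * 'I_w | (rs.1 + rs.2 == w)%N}.

HB.instance Definition _ w := Finite.on (compos2 w).

Definition cfst w (x : compos2 w) : nat := (val x).1.
Definition csnd w (x : compos2 w) : nat := (val x).2.

Lemma cswap_subproof w (x : compos2 w) : ((val x).2 + (val x).1 == w)%N.
Proof. by rewrite addnC; case: x. Qed.

Definition cswap w (x : compos2 w) : compos2 w :=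
  exist (fun rs : 'I_w * 'I_w => is_true (rs.1 + rs.2 == w)%N)
    ((val x).2, (val x).1) (cswap_subproof x).

Section DoubleZetaSpace.
Variable w : nat.

(* Symbols: [inl (inl (r, s))] is Z_{r,s}, [inl (inr (r, s))] is P_{r,s} and
   [inr tt] is Z_w. *)
Definition dz_symbol : finType := (compos2 w + compos2 w + unit)%type.

Definition dz_free : Type := {ffun dz_symbol -> rat^o}.
HB.instance Definition _ := Vector.on dz_free.

Fact dz_gen_key : unit. Proof. exact: tt. Qed.
Definition dz_gen : dz_symbol -> dz_free :=
  locked_with dz_gen_key (fun g => [ffun h => (h == g)%:R]).
Canonical dz_gen_unlockable := [unlockable fun dz_gen].

Definition fZ (x : compos2 w) : dz_free := dz_gen (inl (inl x)).
Definition fP (x : compos2 w) : dz_free := dz_gen (inl (inr x)).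
Definition fZw : dz_free := dz_gen (inr tt).

(* Each relation "lhs = rhs" is encoded as the vector lhs - rhs. *)
Definition dz_rel1 (x : compos2 w) : dz_free :=
  (fZ x + fZ (cswap x)) - (fP x - fZw).

Definition dz_rel2 (y : compos2 w) : dz_free :=
  \sum_(x : compos2 w)
     ('C((cfst x).-1, (cfst y).-1) + 'C((cfst x).-1, (csnd y).-1))%N%:R *: fZ x
  - fP y.

Definition dz_relations : {vspace dz_free} :=
  <<[seq dz_rel1 x | x : compos2 w] ++ [seq dz_rel2 y | y : compos2 w]>>%VS.

Definition dz_space : Type := vs_quot dz_relations.
HB.instance Definition _ := GRing.Lmodule.on dz_space.

Definition dzZ (x : compos2 w) : dz_space := vs_pi dz_relations (fZ x).
Definition dzP (x : compos2 w) : dz_space := vs_pi dz_relations (fP x).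
Definition dzZw : dz_space := vs_pi dz_relations fZw.

Lemma dz_relation1 (x : compos2 w) : dzZ x + dzZ (cswap x) = dzP x - dzZw.
Proof.
rewrite /dzZ /dzP /dzZw -!vs_piD -vs_piB; apply/vs_piP; apply: memv_span.
by rewrite mem_cat; apply/orP; left; apply/imageP; exists x.
Qed.

Lemma dz_relation2 (y : compos2 w) :
  \sum_(x : compos2 w)
     ('C((cfst x).-1, (cfst y).-1) + 'C((cfst x).-1, (csnd y).-1))%N%:R *: dzZ x
  = dzP y.
Proof.
rewrite /dzZ /dzP; under eq_bigr => x _ do rewrite -vs_piZ.
rewrite -vs_pi_sum; apply/vs_piP; apply: memv_span.
by rewrite mem_cat; apply/orP; right; apply/imageP; exists y.
Qed.

End DoubleZetaSpace.

Arguments dzZw : clear implicits.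

Definition pX : {mpoly rat[2]} := 'X_ord0.
Definition pY : {mpoly rat[2]} := 'X_ord_max.

(* [subst2 p A B] is p(A, B). *)
Definition subst2 (p A B : {mpoly rat[2]}) : {mpoly rat[2]} :=
  p \mPo [tuple A; B].

Definition V_ (k : nat) : {pred {mpoly rat[2]}} :=
  [pred p | p \is (k - 2).-homog].

Definition W_ (k : nat) : {pred {mpoly rat[2]}} :=
  [pred p | [&& p \in V_ k,
                p + subst2 p (- pY) pX == 0
              & p + subst2 p (pX - pY) pX + subst2 p pY (pY - pX) == 0]].

Definition Wplus (k : nat) : {pred {mpoly rat[2]}} :=
  [pred p | (p \in W_ k) && (p == subst2 p pY pX)].

(* Main.v *)
(* Send X^(r-1) Y^(s-1) to Z_{r,s} / C(w-2, r-1), for r + s = w. Eliminating the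
   P_{i,j} turns the double shuffle relations into: for every symmetric H of
   degree w - 2, the polynomial H(X, X+Y) - H(X, Y) is sent to a multiple of Z_w.
   Let B = Y p(X+Y, Y) and A(X, Y) = B(X, Y) - B(Y, X). For w = k + 1 the sum to be
   computed is half the image of A(X, Y) - A(-X, Y), up to the terms r = 2 and
   r = k; the period relations show that this polynomial is H(X, X+Y) - H(X, Y)
   with H = X p(X-Y, X) - Y p(X-Y, Y), which is symmetric. The terms r = 2 and
   r = k vanish because b_{k,1} = 0, while b_{1,k}, b_{2,k-1} and b_{k-1,2} are
   multiples of p(1, 1), (dp/dX)(1, 1) and p(1, 0). By Euler's identity and the
   symmetry of p, (dp/dX)(1, 1) is itself a multiple of p(1, 1). *)
Require Import Defs.
From HB Require Import structures.
From mathcomp Require Import all_boot all_order all_algebra.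
From mathcomp Require Import ring zify.
From mathcomp.multinomials Require Import mpoly.

Set Implicit Arguments.
Unset Strict Implicit.
Unset Printing Implicit Defensive.

Import GRing.Theory.
Local Open Scope ring_scope.

(** * Monomials and substitution in two variables *)

Definition mnm2 (i j : nat) : 'X_{1..2} := (U_(ord0) *+ i + U_(ord_max) *+ j)%MM.

Lemma mnm2_fst i j : mnm2 i j ord0 = i.
Proof. by rewrite mnmDE !mulmnE !mnm1E /= mul1n mul0n addn0. Qed.

Lemma mnm2_snd i j : mnm2 i j ord_max = j.
Proof. by rewrite mnmDE !mulmnE !mnm1E /= mul1n mul0n. Qed.

Lemma mnm2_eq i j i' j' : (mnm2 i j == mnm2 i' j') = (i == i') && (j == j').
Proof.
apply/eqP/andP=> [e|[/eqP-> /eqP->]//].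
by rewrite -(mnm2_fst i j) -{2}(mnm2_snd i j) e mnm2_fst mnm2_snd.
Qed.

Lemma mpolyX2 i j : 'X_[mnm2 i j] = pX ^+ i * pY ^+ j.
Proof. by rewrite mpolyXD !mpolyXn. Qed.

Lemma mcoeffX2 i j i' j' :
  (pX ^+ i * pY ^+ j)@_(mnm2 i' j') = ((i == i') && (j == j'))%:R.
Proof. by rewrite -mpolyX2 mcoeffX mnm2_eq. Qed.

(** Only the term in Y^b of the binomial expansion contributes; the equality of total degrees then
    forces its X-exponent to be a. *)
Lemma mcoeff_XXDY i j a b : (i + j = a + b)%N ->
  (pX ^+ i * (pX + pY) ^+ j)@_(mnm2 a b) = 'C(j, b)%:R.
Proof.
move=> e; rewrite exprDn mulr_sumr raddf_sum /=.
under eq_bigr => l _ do rewrite mulrnAr mulrA -exprD mcoeffMn mcoeffX2.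
have [ltbj|ltjb] := ltnP b j.+1; last first.
  rewrite bin_small // big1 // => -[l /= ltl] _.
  by rewrite [l == b]ltn_eqF ?andbF ?mul0rn //; lia.
rewrite (bigD1 (Ordinal ltbj)) //= big1 => [|l /negPf nl].
  rewrite eqxx andbT addr0 (_ : (_ == a) = true) //; lia.
by rewrite [_ == b](nl) andbF mul0rn.
Qed.

Lemma mdeg2 (m : 'X_{1..2}) : mdeg m = (m ord0 + m ord_max)%N.
Proof. by rewrite mdegE big_ord_recl big_ord1; congr (_ + m _)%N; apply: val_inj. Qed.

Lemma subst2E p A B :
  subst2 p A B = \sum_(m <- msupp p) p@_m *: (A ^+ m ord0 * B ^+ m ord_max).
Proof.
rewrite /subst2 comp_mpolyE; apply: eq_bigr => m _; congr (_ *: _).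
rewrite big_ord_recl big_ord1; congr (_ * _ ^+ m _); exact: val_inj.
Qed.

Lemma subst2_id p : subst2 p pX pY = p.
Proof.
rewrite -[RHS]comp_mpoly_id /subst2; congr (_ \mPo _); apply: eq_from_tnth => i.
rewrite tnth_mktuple; case: i => -[|[|//]] lti; rewrite (tnth_nth 0) /=;
  congr 'X_ _; exact: val_inj.
Qed.

Lemma subst2_pX A B : subst2 pX A B = A.
Proof. exact: comp_mpolyXU. Qed.

Lemma subst2_pY A B : subst2 pY A B = B.
Proof. exact: comp_mpolyXU. Qed.

Lemma subst20 A B : subst2 0 A B = 0.
Proof. exact: rmorph0. Qed.

Lemma subst2D p q A B : subst2 (p + q) A B = subst2 p A B + subst2 q A B.
Proof. exact: rmorphD. Qed.

Lemma subst2N p A B : subst2 (- p) A B = - subst2 p A B.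
Proof. exact: rmorphN. Qed.

Lemma subst2M p q A B : subst2 (p * q) A B = subst2 p A B * subst2 q A B.
Proof. exact: rmorphM. Qed.

Lemma subst2Xn p n A B : subst2 (p ^+ n) A B = subst2 p A B ^+ n.
Proof. exact: rmorphXn. Qed.

Lemma subst2Z c p A B : subst2 (c *: p) A B = c *: subst2 p A B.
Proof. exact: linearZ. Qed.

Lemma subst2_sum (I : Type) (r : seq I) (F : I -> {mpoly rat[2]}) A B :
  subst2 (\sum_(i <- r) F i) A B = \sum_(i <- r) subst2 (F i) A B.
Proof. exact: rmorph_sum. Qed.

Lemma subst2_comp p A B C D :
  subst2 (subst2 p A B) C D = subst2 p (subst2 A C D) (subst2 B C D).
Proof.
rewrite (subst2E p A B) subst2_sum [RHS]subst2E; apply: eq_bigr => m _.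
by rewrite subst2Z subst2M !subst2Xn.
Qed.

Definition subst2_simp :=
  (subst2_comp, subst2D, subst2N, subst2M, subst2Xn, subst2_pX, subst2_pY).

Lemma subst2_homog n p A B : p \is n.-homog -> A \is 1.-homog ->
  B \is 1.-homog -> subst2 p A B \is n.-homog.
Proof.
move=> /dhomogP hp hA hB; rewrite subst2E big_seq rpred_sum // => m mp.
have <- : (m ord0 + m ord_max)%N = n by rewrite -mdeg2; apply: hp.
by rewrite rpredZ // dhomogM // -[X in X.-homog]mul1n dhomogMn.
Qed.

Lemma pX_homog : pX \is 1.-homog. Proof. by rewrite dhomogX; apply/eqP; exact: mdeg1. Qed.
Lemma pY_homog : pY \is 1.-homog. Proof. by rewrite dhomogX; apply/eqP; exact: mdeg1. Qed.


(** * Index pairs and a binomial identity *)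

Lemma compos2P w (x : compos2 w) :
  [/\ (0 < cfst x)%N, (0 < csnd x)%N & (cfst x + csnd x = w)%N].
Proof.
by case: x => -[[r ltr] [s lts]] /=; rewrite /cfst /csnd /= => /eqP /=; split; lia.
Qed.

Lemma cfst_inj w : injective (@cfst w).
Proof.
move=> x y e; have [_ _ ex] := compos2P x; have [_ _ ey] := compos2P y.
have e2 : csnd x = csnd y by apply: (@addnI (cfst x)); rewrite ex e ey.
apply: val_inj; apply: injective_projections; exact: val_inj.
Qed.

Lemma compos2_ex w i j : (i + j).+2 = w ->
  exists x : compos2 w, cfst x = i.+1 /\ csnd x = j.+1.
Proof.
move=> e; have lti : (i.+1 < w)%N by lia.
have ltj : (j.+1 < w)%N by lia.
have eij : (Ordinal lti + Ordinal ltj == w)%N by apply/eqP => /=; lia.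
by exists (exist _ (Ordinal lti, Ordinal ltj) eij).
Qed.

Lemma cswapK w : involutive (@cswap w).
Proof. by move=> x; apply: cfst_inj. Qed.

(** Both sides equal n! / (i! (n-a)! (a-i)!), or vanish when a < i. This trades the weights 1 /
    C(w-2, r-1) for the binomials of the double shuffle relations. *)
Lemma mul_bin_sub n a i : (a <= n)%N -> (i <= n)%N ->
  ('C(n, a) * 'C(a, i) = 'C(n, i) * 'C(n - i, n - a))%N.
Proof.
move=> lean lein; have [ltai|leia] := ltnP a i.
  by rewrite (bin_small ltai) (@bin_small (n - i)) ?muln0 //; lia.
have f1 := bin_fact lean; have f2 := bin_fact leia.
have f3 := bin_fact lein.
have f4 := @bin_fact (n - i) (n - a) ltac:(lia).
rewrite (_ : n - i - (n - a) = a - i)%N in f4; last lia.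
have h : (0 < i`! * (n - a)`! * (a - i)`!)%N by rewrite !muln_gt0 !fact_gt0.
apply/eqP; rewrite -(eqn_pmul2r h); apply/eqP.
transitivity ('C(n, a) * (('C(a, i) * (i`! * (a - i)`!)) * (n - a)`!))%N; first ring.
rewrite f2 f1 -f3 -f4; ring.
Qed.

(** * The linear map from polynomials to the double zeta space *)

(** Defined on all polynomials, so as to be linear: monomials of degree other than w - 2 go to 0. *)
Definition dzmap w (f : {mpoly rat[2]}) : dz_space w :=
  \sum_(x : compos2 w)
    (f@_(mnm2 (cfst x).-1 (csnd x).-1) / 'C(w - 2, (cfst x).-1)%:R) *: dzZ x.

Lemma dzmap_is_linear w : linear (@dzmap w).
Proof.
move=> c f g; rewrite /dzmap scaler_sumr -big_split; apply: eq_bigr => x _ /=.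
by rewrite mcoeffD mcoeffZ mulrDl scalerDl scalerA mulrA.
Qed.

HB.instance Definition _ w :=
  GRing.isLinear.Build rat {mpoly rat[2]} (dz_space w) *:%R (@dzmap w)
    (@dzmap_is_linear w).

Lemma dzmapX w (x : compos2 w) :
  dzmap w (pX ^+ (cfst x).-1 * pY ^+ (csnd x).-1)
  = 'C(w - 2, (cfst x).-1)%:R^-1 *: dzZ x.
Proof.
rewrite /dzmap (bigD1 x) //= mcoeffX2 !eqxx /= mul1r big1 ?addr0 // => y nyx.
rewrite mcoeffX2 (_ : _ && _ = false) ?mul0r ?scale0r //.
apply: contra_neqF nyx => /andP[/eqP e _]; apply: cfst_inj.
by have [? ? _] := compos2P x; have [? ? _] := compos2P y; move: e; lia.
Qed.

Lemma bin_compos_neq0 w (x : compos2 w) : 'C(w - 2, (cfst x).-1)%:R != 0 :> rat.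
Proof.
rewrite Num.Theory.pnatr_eq0 -lt0n bin_gt0.
by have [? ? ?] := compos2P x; lia.
Qed.

Lemma bin_cswap w (x : compos2 w) :
  'C(w - 2, (csnd x).-1) = 'C(w - 2, (cfst x).-1).
Proof.
have [? ? ?] := compos2P x; rewrite -bin_sub; last lia.
by congr 'C(_, _); lia.
Qed.

(** With N = 1 / C(w-2, i), the terms in X + Y go to N P_{i+1,j+1} by the second family of
    relations, the plain monomials to N (P_{i+1,j+1} - Z_w) by the first; the P's cancel. *)
Lemma dzmap_double_shuffle w i j : (i + j).+2 = w ->
  dzmap w (pX ^+ i * (pX + pY) ^+ j + pX ^+ j * (pX + pY) ^+ i
           - (pX ^+ i * pY ^+ j + pX ^+ j * pY ^+ i))
  = 'C(w - 2, i)%:R^-1 *: dzZw w.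
Proof.
move=> ew; have [y [ey1 ey2]] := compos2_ex ew.
have ei : i = (cfst y).-1 by rewrite ey1.
have ej : j = (csnd y).-1 by rewrite ey2.
set N := _^-1.
have eM : dzmap w (pX ^+ i * pY ^+ j + pX ^+ j * pY ^+ i)
          = N *: (dzP y - dzZw w).
  have -> : pX ^+ i * pY ^+ j = pX ^+ (cfst y).-1 * pY ^+ (csnd y).-1.
    by rewrite ei ej.
  have -> : pX ^+ j * pY ^+ i
            = pX ^+ (cfst (cswap y)).-1 * pY ^+ (csnd (cswap y)).-1.
    by rewrite ei ej.
  rewrite linearD /= !dzmapX [cfst (cswap y)]/(csnd y) bin_cswap -ei.
  by rewrite -scalerDr dz_relation1.
have eS : dzmap w (pX ^+ i * (pX + pY) ^+ j + pX ^+ j * (pX + pY) ^+ i)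
          = N *: dzP y.
  rewrite -dz_relation2 scaler_sumr; apply: eq_bigr => x _.
  have [x1 x2 ex] := compos2P x.
  rewrite mcoeffD !mcoeff_XXDY; [|lia|lia].
  rewrite scalerA; congr (_ *: _).
  have nx := bin_compos_neq0 x; have ny := bin_compos_neq0 y.
  rewrite -ei in ny *; rewrite -ej /N.
  (* Both denominators are cleared, which leaves an identity between natural numbers. *)
  apply: (canLR (mulfK nx)); rewrite -mulrA; apply: (canRL (mulKf ny)).
  rewrite -natrD -!natrM; congr (_%:R).
  have le : ((cfst x).-1 <= w - 2)%N by lia.
  have b1 := @mul_bin_sub _ _ i le ltac:(lia).
  have b2 := @mul_bin_sub _ _ j le ltac:(lia).
  rewrite (_ : w - 2 - i = j)%N in b1; last lia.
  rewrite (_ : w - 2 - j = i)%N in b2; last lia.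
  rewrite (_ : w - 2 - (cfst x).-1 = (csnd x).-1)%N in b1 b2; last lia.
  have := bin_cswap y; rewrite -ei -ej => eij; rewrite eij in b2.
  by rewrite mulnDr -b1 -b2 [RHS]mulnC mulnDr.
by rewrite linearB /= eM eS -scalerBr opprB addrC subrK.
Qed.

Lemma dzmap_sym w H : (2 <= w)%N -> H \is (w - 2).-homog -> subst2 H pY pX = H ->
  exists c, dzmap w (subst2 H pX (pX + pY) - H) = c *: dzZw w.
Proof.
move=> w2 /dhomogP hH symH.
exists (2%:R^-1 * \sum_(m <- msupp H) (H@_m / 'C(w - 2, m ord0)%:R)).
(* Averaging with the swapped polynomial makes each monomial of H contribute one symmetric pair, to
   which [dzmap_double_shuffle] applies. *)
have -> : subst2 H pX (pX + pY) - H = 2%:R^-1 *: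
   (subst2 H pX (pX + pY) + subst2 H (pX + pY) pX - (subst2 H pX pY + subst2 H pY pX)).
  have -> : subst2 H (pX + pY) pX = subst2 H pX (pX + pY).
    by rewrite -{1}symH !subst2_simp.
  rewrite subst2_id symH -!mulr2n -mulrnBl -scaler_nat scalerA mulVf ?scale1r //.
rewrite linearZ /= -scalerA; congr (_ *: _).
rewrite !subst2E -!big_split -sumrB linear_sum scaler_suml /= !big_seq.
apply: eq_bigr => m mH; rewrite -!scalerDr -scalerBr linearZ /= -scalerA.
have e : (m ord0 + m ord_max).+2 = w by rewrite -mdeg2 [mdeg m](hH m mH); lia.
congr (_ *: _); rewrite -(dzmap_double_shuffle e).
by rewrite ![pX ^+ m ord_max * _]mulrC.
Qed.

(** * Coefficients of Y p(X+Y, Y) *)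

Lemma mcoeff_swap f i j : (subst2 f pY pX)@_(mnm2 i j) = f@_(mnm2 j i).
Proof.
rewrite -[in RHS](subst2_id f) !subst2E !raddf_sum; apply: eq_bigr => m _ /=.
by rewrite !mcoeffZ mulrC mulrC [pY ^+ _ * _]mulrC !mcoeffX2 andbC.
Qed.

Lemma mcoeff_YXDY i j a b : (i + j = a + b)%N ->
  (pY ^+ i * (pX + pY) ^+ j)@_(mnm2 a b) = 'C(j, a)%:R.
Proof.
move=> e; rewrite -mcoeff_swap !subst2_simp [pY + pX]addrC mcoeff_XXDY //.
by rewrite e addnC.
Qed.

(** A monomial X^u Y^v of p becomes (X+Y)^u Y^(v+1), where X^a has binomial coefficient C(u, a). *)
Lemma mcoeff_mulY_subst2 n p a b : p \is n.-homog -> (a + b = n.+1)%N ->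
  (pY * subst2 p (pX + pY) pY)@_(mnm2 a b)
  = \sum_(m <- msupp p) p@_m * 'C(m ord0, a)%:R.
Proof.
move=> /dhomogP hp e; rewrite subst2E mulr_sumr raddf_sum /= !big_seq.
apply: eq_bigr => m mp; rewrite -scalerAr mcoeffZ; congr (_ * _).
rewrite mulrCA -exprS mulrC mcoeff_YXDY //.
by rewrite e addSn addnC -mdeg2 [mdeg m](hp m mp).
Qed.

(** The same coefficient, read off from p(Y, X+Y) instead of p(X+Y, Y). *)
Lemma mcoeff_mulY_subst2_sym n p a b : p \is n.-homog -> subst2 p pY pX = p ->
  (a + b = n.+1)%N ->
  (pY * subst2 p (pX + pY) pY)@_(mnm2 a b)
  = \sum_(m <- msupp p) p@_m * 'C(m ord_max, a)%:R.
Proof.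
move=> /dhomogP hp symp e; rewrite -{1}symp !subst2_simp.
rewrite subst2E mulr_sumr raddf_sum /= !big_seq.
apply: eq_bigr => m mp; rewrite -scalerAr mcoeffZ mulrA -exprS.
rewrite mcoeff_YXDY // e addSn -mdeg2 [mdeg m](hp m mp) //.
Qed.

(** * Consequences of the period relations *)

(** Symmetry turns the relation p(X,Y) + p(-Y,X) = 0 into oddness in each variable. Stating the
    relations at arbitrary A, B allows evaluation both at numbers and at linear forms. *)
Lemma WplusP k p : p \in Wplus k ->
  [/\ p \is (k - 2).-homog,
      forall A B, subst2 p A B = subst2 p B A,
      forall A B, subst2 p A (- B) = - subst2 p A B &
      forall A B, subst2 p A B + subst2 p (A - B) A + subst2 p B (B - A) = 0].
Proof.
case/andP=> /and3P[hp /eqP h2 /eqP h3] /eqP h.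
have sym A B : subst2 p A B = subst2 p B A by rewrite {1}h !subst2_simp.
split; [exact: hp|exact: sym| |] => A B.
  have := congr1 (fun q => subst2 q A B) h2.
  by rewrite /= !subst2_simp (sym (- B)) subst20 addrC => /eqP; rewrite addr_eq0 => /eqP.
have := congr1 (fun q => subst2 q A B) h3.
by rewrite /= !subst2_simp subst20.
Qed.

(** Oddness in the second variable gives p(1,0) = -p(1,0). *)
Lemma Wplus_eval10 k p : p \in Wplus k -> subst2 p 1 0 = 0.
Proof.
case/WplusP=> _ sym odd _.
have /eqP := odd 1 0; rewrite oppr0 -addr_eq0 -mulr2n -scaler_nat.
by rewrite scaler_eq0 Num.Theory.pnatr_eq0 => /eqP.
Qed.

(** The three-term relation at (1, 1) is p(1,1) + p(0,1) + p(1,0) = 0. *)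
Lemma Wplus_eval11 k p : p \in Wplus k -> subst2 p 1 1 = 0.
Proof.
move=> hp; have [_ sym _ three] := WplusP hp.
by have := three 1 1; rewrite subrr (sym 0) (Wplus_eval10 hp) !addr0.
Qed.

Lemma Wplus_sum_coef k p : p \in Wplus k -> \sum_(m <- msupp p) p@_m = 0.
Proof.
move=> /Wplus_eval11 h; have := congr1 (mcoeff 0%MM) h.
rewrite subst2E raddf_sum mcoeff0 /= => {2}<-; apply: eq_bigr => m _.
by rewrite !expr1n mulr1 mcoeffZ mcoeff1 eqxx mulr1.
Qed.

(* [p] is symmetric, so the sum is also that of [p@_m * m ord_max]; the two add up
   to [(k - 2) * p(1, 1)]. *)
Lemma Wplus_sum_degX k p : p \in Wplus k ->
  \sum_(m <- msupp p) p@_m * (m ord0)%:R = 0.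
Proof.
move=> hp; have [hom sym _ _] := WplusP hp.
have symp : subst2 p pY pX = p by rewrite sym subst2_id.
have e : (1 + (k - 2) = (k - 2).+1)%N by [].
have e0 := mcoeff_mulY_subst2 hom e.
have := mcoeff_mulY_subst2_sym hom symp e; rewrite e0.
under eq_bigr => m _ do rewrite bin1.
under [RHS]eq_bigr => m _ do rewrite bin1.
move=> e1; apply/eqP; set S := (X in X == 0).
have : S + S == 0.
  rewrite {2}/S e1 -big_split /=; under eq_bigr => m _ do rewrite -mulrDr -natrD.
  rewrite big_seq; move/dhomogP: hom => hom.
  under eq_bigr => m mp do rewrite -mdeg2 [mdeg m](hom m mp).
  by rewrite -big_seq -mulr_suml (Wplus_sum_coef hp) mul0r.
by rewrite -mulr2n Num.Theory.mulrn_eq0.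
Qed.

(** The binomial is 1 for the monomial X^(k-2) and 0 for every other one, so the sum is p(1,0). *)
Lemma Wplus_sum_bin_top k p : p \in Wplus k ->
  \sum_(m <- msupp p) p@_m * 'C(m ord0, k - 2)%:R = 0.
Proof.
move=> hp; have [/dhomogP hom _ _ _] := WplusP hp.
have := congr1 (mcoeff 0%MM) (Wplus_eval10 hp).
rewrite subst2E raddf_sum mcoeff0 /= => {2}<-; rewrite !big_seq.
apply: eq_bigr => m mp; rewrite expr1n mul1r mcoeffZ; congr (_ * _).
have : (m ord0 + m ord_max)%N = (k - 2)%N by rewrite -mdeg2; exact: hom.
rewrite expr0n; case: eqP => [->|/eqP n0] e; rewrite ?mcoeff1 ?mcoeff0.
  by rewrite eqxx -e addn0 binn.
by rewrite bin_small // -e -{1}[m ord0]addn0 ltn_add2l lt0n.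
Qed.

Lemma Wplus_sum_bin_above k p : p \in Wplus k ->
  \sum_(m <- msupp p) p@_m * 'C(m ord0, (k - 2).+1)%:R = 0.
Proof.
move=> hp; have [/dhomogP hom _ _ _] := WplusP hp.
rewrite big_seq big1 // => m mp.
have : (m ord0 + m ord_max)%N = (k - 2)%N by rewrite -mdeg2; exact: hom.
by move=> <-; rewrite bin_small ?mulr0 // ltnS leq_addr.
Qed.

(* The identity defining the b_{r,s} has a factor Y^{s-2}, which is Y^{-1} for
   s = 1; both sides are multiplied by Y (so b_{k,1} = 0 is a consequence). *)
Theorem theorem2 (k : nat) (hk : (12 <= k)%N) (hk2 : ~~ odd k)
  (p : {mpoly rat[2]}) (hp : p \in Wplus k)
  (b : compos2 k.+1 -> rat)
  (hb : pY * subst2 p (pX + pY) pY =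
        \sum_(x : compos2 k.+1)
          ('C(k.-1, (cfst x).-1)%:R * b x) *:
            (pX ^+ (cfst x).-1 * pY ^+ (csnd x).-1)) :
  exists c : rat,
    \sum_(x : compos2 k.+1 | (4 <= cfst x <= k - 2)%N && ~~ odd (cfst x))
      (b x - b (cswap x)) *: dzZ x
    = c *: dzZw k.+1.

Proof.
have [hom sym oddp three] := WplusP hp.
have ek : k.-1 = (k.+1 - 2)%N by lia.
rewrite ek in hb.
(* With B = Y p(X+Y, Y), this is the image of B(sX, tY), and [dzBs] gives that of B(sY, tX); only
   the values 1 and -1 of s and t are used. *)
have dzB s t : dzmap k.+1 (subst2 (pY * subst2 p (pX + pY) pY) (s *: pX) (t *: pY))
    = \sum_(x : compos2 k.+1) (s ^+ (cfst x).-1 * t ^+ (csnd x).-1 * b x) *: dzZ x.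
  rewrite hb subst2_sum linear_sum; apply: eq_bigr => x _ /=.
  rewrite subst2Z subst2M !subst2Xn subst2_pX subst2_pY !exprZn.
  rewrite -scalerAl -scalerAr !scalerA linearZ /= dzmapX scalerA; congr (_ *: _).
  by have := bin_compos_neq0 x; set N := _%:R => nz; field.
have dzBs s t : dzmap k.+1 (subst2 (pY * subst2 p (pX + pY) pY) (s *: pY) (t *: pX))
    = \sum_(x : compos2 k.+1) (t ^+ (cfst x).-1 * s ^+ (csnd x).-1 * b (cswap x)) *: dzZ x.
  rewrite hb subst2_sum linear_sum (reindex_inj (inv_inj (@cswapK _))).
  apply: eq_bigr => x _ /=.
  rewrite subst2Z subst2M !subst2Xn subst2_pX subst2_pY !exprZn.
  rewrite -scalerAl -scalerAr !scalerA [_ * pX ^+ _]mulrC linearZ /= dzmapX scalerA.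
  rewrite [cfst (cswap x)]/(csnd x) bin_cswap; congr (_ *: _).
  rewrite [csnd (cswap x)]/(cfst x).
  by have := bin_compos_neq0 x; set N := _%:R => nz; field.
(* Coefficients of X^(r-1) Y^(s-1) are compared in [hb]; the vanishing of some b_{r,s} thus reduces
   to that of sums over the monomials of p. *)
have bE x : 'C(k.+1 - 2, (cfst x).-1)%:R * b x
    = \sum_(m <- msupp p) p@_m * 'C(m ord0, (cfst x).-1)%:R.
  have [x1 x2 ex] := compos2P x.
  rewrite -(@mcoeff_mulY_subst2 (k - 2) _ _ (csnd x).-1) //; last lia.
  rewrite hb raddf_sum (bigD1 x) //= mcoeffZ mcoeffX2 !eqxx mulr1 big1 ?addr0 //.
  move=> y nyx; rewrite mcoeffZ mcoeffX2 (_ : _ && _ = false) ?mulr0 //.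
  apply: contra_neqF nyx => /andP[/eqP e _]; apply: cfst_inj.
  by have [? ? _] := compos2P y; move: e; lia.
have b0 x l : (cfst x).-1 = l -> \sum_(m <- msupp p) p@_m * 'C(m ord0, l)%:R = 0 ->
    b x = 0.
  move=> el; rewrite -el -bE => /eqP.
  by rewrite mulf_eq0 (negPf (bin_compos_neq0 x)) => /eqP.
have s0 : \sum_(m <- msupp p) p@_m * 'C(m ord0, 0)%:R = 0.
  by under eq_bigr => m _ do rewrite bin0 mulr1; exact: (Wplus_sum_coef hp).
have s1 : \sum_(m <- msupp p) p@_m * 'C(m ord0, 1)%:R = 0.
  by under eq_bigr => m _ do rewrite bin1; exact: (Wplus_sum_degX hp).
pose H := pX * subst2 p (pX - pY) pX - pY * subst2 p (pX - pY) pY.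
have symH : subst2 H pY pX = H.
  rewrite /H !subst2_simp -[pY - pX]opprB (sym (- _)) oddp (sym (- _)) oddp.
  rewrite (sym pX) (sym pY).
  by move: (subst2 p _ pX) (subst2 p _ pY) => u v; ring.
have homH : H \is (k.+1 - 2).-homog.
  have -> : (k.+1 - 2 = 1 + (k - 2))%N by lia.
  have hX := pX_homog; have hY := pY_homog.
  by rewrite rpredB // dhomogM // subst2_homog // rpredB.
have [c hc] := dzmap_sym (ltac:(lia) : (2 <= k.+1)%N) homH symH.
exists (2%:R^-1 * c); rewrite -scalerA -hc.
(* [f1], [f2], [f3], [f4] are B(X,Y), B(Y,X), B(-X,Y), B(Y,-X), so that [f1 - f2 - f3 + f4] is
   A(X,Y) - A(-X,Y). *)
have := dzB 1 1; have := dzBs 1 1; have := dzB (-1) 1; have := dzBs 1 (-1).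
set f4 := subst2 _ _ _; set f3 := subst2 _ _ (1 *: pY).
set f2 := subst2 _ (1 *: pY) _; set f1 := subst2 _ (1 *: pX) _ => e4 e3 e2 e1.
have -> : subst2 H pX (pX + pY) - H = f1 - f2 - f3 + f4.
  rewrite /f1 /f2 /f3 /f4 /H !scaleN1r !scale1r !subst2_simp.
  have oddl A C : subst2 p (- A) C = - subst2 p A C by rewrite sym oddp sym.
  have -> : pX - (pX + pY) = - pY by ring.
  have -> : - pX + pY = - (pX - pY) by ring.
  have -> : pY - pX = - (pX - pY) by ring.
  rewrite !oddl oddp (sym pY pX) (sym pY (pX + pY)) (addrC pY pX).
  (* After oddness and symmetry this instance reads p(X+Y,Y) + p(X+Y,X) = p(X,Y); the rest is ring
     algebra. *)
  have := three (pX + pY) pY.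
  have -> : pX + pY - pY = pX by ring.
  have -> : pY - (pX + pY) = - pX by ring.
  rewrite oddp (sym pX (pX + pY)) (sym pY pX).
  move: (subst2 p (pX + pY) pY) (subst2 p (pX + pY) pX) (subst2 p pX pY)
    (subst2 p (pX - pY) pX) (subst2 p (pX - pY) pY) => u v c1 a1 a2.
  by move=> /eqP; rewrite subr_eq0 => /eqP <-; ring.
clearbody f1 f2 f3 f4; rewrite linearD !linearB /= e1 e2 e3 e4 -!sumrB -big_split /= scaler_sumr.
rewrite [RHS](bigID (fun x => (4 <= cfst x <= k - 2)%N && ~~ odd (cfst x))) /=.
(* The four signs combine to 1 - (-1)^(r-1) = 1 + (-1)^r: odd r drop out, and even r get a factor 2,
   which the 1/2 in the witness cancels. *)
have coefE x : (1 ^+ (cfst x).-1 * 1 ^+ (csnd x).-1 * b x) *: dzZ x -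
    (1 ^+ (cfst x).-1 * 1 ^+ (csnd x).-1 * b (cswap x)) *: dzZ x -
    ((-1) ^+ (cfst x).-1 * 1 ^+ (csnd x).-1 * b x) *: dzZ x +
    ((-1) ^+ (cfst x).-1 * 1 ^+ (csnd x).-1 * b (cswap x)) *: dzZ x
  = ((1 + (-1) ^+ (odd (cfst x))) * (b x - b (cswap x))) *: dzZ x.
  rewrite -!scalerBl -scalerDl; congr (_ *: _); rewrite !expr1n.
  have [x1 _ _] := compos2P x; rewrite -(prednK x1) /= -[(-1) ^+ (cfst x).-1]signr_odd.
  by case: (odd _); rewrite /= ?expr0 ?expr1; ring.
rewrite [X in _ = _ + X]big1 ?addr0 => [|x xend].
  apply: eq_bigr => x /andP[_ /negPf ex].
  by rewrite coefE ex scalerA mulrA mulVf // mul1r.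
rewrite coefE; case: (boolP (odd (cfst x))) xend => [_ _|xeven].
  by rewrite expr1 subrr mul0r scale0r scaler0.
rewrite andbT => xend; suff [-> ->] : b x = 0 /\ b (cswap x) = 0.
  by rewrite subrr mulr0 scale0r scaler0.
have [x1 x2 ex] := compos2P x.
have esw : cfst (cswap x) = csnd x by [].
(* As k is even, these are the only even r outside the range. For r = 2 the indices r - 1 of the two
   coefficients are 1 and k - 2; for r = k they are k - 1 and 0. *)
have [e|e] : cfst x = 2%N \/ cfst x = k by move: xeven xend ex; lia.
  split; first by apply: (b0 _ 1%N) => //; rewrite e.
  by apply: (b0 _ (k - 2)%N) => //; [rewrite esw; lia|exact: Wplus_sum_bin_top].
split; last by apply: (b0 _ 0%N) => //; rewrite esw; lia.
by apply: (b0 _ (k - 2).+1) => //; [lia|exact: Wplus_sum_bin_above].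
Qed.
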